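(* Let $h>0$ and let $\lambda,\mu\in\mathbb{R}$ satisfy $\mu>0$, $\lambda+\mu>0$. The functions $N_{\mathrm{DF}}$ and $N_{\mathrm{FD}}$ (given by the explicit formulas in the context) admit the two-term asymptotic expansions, as $\Lambda\to+\infty$, $$N_{\mathrm{DF}}(\Lambda)=\frac h2\left(\frac1\mu+\frac1{\lambda+2\mu}\right)\Lambda+\left(\frac1{\mu^{1/2}}-\frac1{(\lambda+2\mu)^{1/2}}\right)\Lambda^{1/2}+o(\Lambda^{1/2}),$$ $$N_{\mathrm{FD}}(\Lambda)=\frac h2\left(\frac1\mu+\frac1{\lambda+2\mu}\right)\Lambda-\left(\frac1{\mu^{1/2}}-\frac1{(\lambda+2\mu)^{1/2}}\right)\Lambda^{1/2}+o(\Lambda^{1/2}).$$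
   Context: For $\Lambda>0$, with $\lfloor\cdot\rfloor$ the floor function, $$N_{\mathrm{DF}}(\Lambda)=\left\lfloor\frac h\pi\sqrt{\frac{\Lambda}{\lambda+2\mu}}\right\rfloor+\left\lfloor\frac h\pi\sqrt{\frac{\Lambda}{\mu}}\right\rfloor+2\left\lfloor\sqrt{\frac\Lambda\mu}\right\rfloor+2\sum_{n=1}^{\left\lfloor\sqrt{\Lambda/\mu}\right\rfloor}\left\lfloor\frac h\pi\sqrt{\frac\Lambda\mu-n^2}\right\rfloor+2\sum_{n=1}^{\left\lfloor\sqrt{\Lambda/(\lambda+2\mu)}\right\rfloor}\left\lfloor\frac h\pi\sqrt{\frac\Lambda{\lambda+2\mu}-n^2}\right\rfloor,$$ $$N_{\mathrm{FD}}(\Lambda)=N_{\mathrm{DF}}(\Lambda)+2\left(\left\lfloor\sqrt{\frac{\Lambda}{\lambda+2\mu}}\right\rfloor-\left\lfloor\sqrt{\frac\Lambda\mu}\right\rfloor\right).$$ *)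

(* Defs.v *)
From mathcomp Require Import all_boot all_order all_algebra.
From mathcomp Require Import archimedean.
From mathcomp Require Import all_classical all_reals all_analysis.

Set Implicit Arguments.
Unset Strict Implicit.
Unset Printing Implicit Defensive.

Import Order.TTheory GRing.Theory Num.Theory.
Import numFieldNormedType.Exports.

Local Open Scope ring_scope.

(* The Landau notations look up the filter structure of +oo_R, for which the
   library declares only a typeclass instance. *)
Canonical pinfty_filter_on (R : numFieldType) :=
  FilterType (pinfty_nbhs R) (@filter_filter _ _ proper_pinfty_nbhs).

(* The counting functions are integer valued, since N_FD subtracts floors.
   The upper limits of summation must be natural numbers: Num.truncn x is the
   floor of x for x >= 0, which is the case of every (total) square root. *)
Definition N_DF (R : realType) (h lambda mu Lambda : R) : int :=
    Num.floor (h / pi * Num.sqrt (Lambda / (lambda + 2 * mu)))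
  + Num.floor (h / pi * Num.sqrt (Lambda / mu))
  + 2 * Num.floor (Num.sqrt (Lambda / mu))
  + 2 * (\sum_(1 <= n < (Num.truncn (Num.sqrt (Lambda / mu))).+1)
           Num.floor (h / pi * Num.sqrt (Lambda / mu - n%:R ^+ 2)))
  + 2 * (\sum_(1 <= n < (Num.truncn (Num.sqrt (Lambda / (lambda + 2 * mu)))).+1)
           Num.floor
             (h / pi * Num.sqrt (Lambda / (lambda + 2 * mu) - n%:R ^+ 2))).

Definition N_FD (R : realType) (h lambda mu Lambda : R) : int :=
    N_DF h lambda mu Lambda
  + 2 * (Num.floor (Num.sqrt (Lambda / (lambda + 2 * mu)))
         - Num.floor (Num.sqrt (Lambda / mu))).

(* Main.v *)
Require Import Defs.
From mathcomp Require Import all_boot all_order all_algebra.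
From mathcomp Require Import all_classical all_reals all_analysis.
From mathcomp Require Import zify ring lra.

Set Implicit Arguments.
Unset Strict Implicit.
Unset Printing Implicit Defensive.

Import Order.TTheory GRing.Theory Num.Theory.
Import numFieldNormedType.Exports.

Local Open Scope classical_set_scope.
Local Open Scope ring_scope.

(** Both counting functions are sums over the two wave speeds of a lattice point
    count.  With [X] equal to [Lambda] over [mu] or over [lambda + 2 mu],
    [r = Num.sqrt X] and [a = h / pi], the double sum over [n] counts the points
    of positive integer coordinates under the quarter ellipse
    [a * Num.sqrt (r ^+ 2 - n ^+ 2)], whose area is [h * r ^+ 2 / 4].  This
    count is the area minus half the semi-axes, [(1 + a) r / 2], up to [o(r)]
    ([sum_floor_circ]).  Doubling it and adding the floor of [a r] gives
    [h / 2 * X - r + o(r)] for each speed ([wave_count_asymptotics]); the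
    two problems differ only by the additional term, twice the floor of [r], which
    is taken at the speed of [mu] for N_DF and of [lambda + 2 mu] for N_FD and turns
    one of the two [- r] into [+ r].

    The count is split as floor = value - 1/2 - sawtooth.  The sum of the values
    is evaluated by the trapezoidal rule ([sum_circ]), the derivatives of the
    circle being replaced by exact algebraic identities and the vertical
    tangent at [r] by a telescoping sum.

    The heart of the matter is that the fractional parts are equidistributed,
    that is, that the sawtooth sum is [o(r)] ([sum_saw_circ]).  The argument
    is elementary, without exponential sums.  Over a bounded number of steps
    the ordinates form an arithmetic progression up to [O(1 / r)].  Its slope has a
    Dirichlet approximation [p / q] with [q <= Q], and over [q] consecutive
    steps the fractional parts are almost [q] equally spaced points, so that
    the sawtooth sum of this block is bounded ([norm_sum_saw_perturbed]).
    This is a gain unless [q <= K] is small.  But then the slope is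
    within [O(1 / Q)] of one of boundedly many fractions, and since the slope
    moves strictly, at a rate at least [a / r], few integers are
    concerned ([sum_rational_weight_le]).  Letting [K] be large, then [Q]
    larger, then [r] larger, the total is [o(r)]
    ([sum_saw_slowly_turning]). *)

(** * Fractional parts along an arithmetic progression *)

Definition saw (R : realType) (x : R) : R := x - (Num.floor x)%:~R - 1 / 2.

Lemma norm_saw_le (R : realType) (x : R) : `|saw x| <= 1 / 2.
Proof.
have /andP[h1 h2] := floor_itv x; rewrite intrD in h2.
by rewrite ler_norml /saw; apply/andP; split; lra.
Qed.

(** The sawtooth only jumps downwards; this one-sided Lipschitz bound is what
    makes block sums stable under perturbation of the arguments. *)
Lemma saw_le_add (R : realType) (x y : R) : x <= y -> saw y <= saw x + (y - x).
Proof.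
move=> xy; have : (Num.floor x)%:~R <= (Num.floor y)%:~R :> R.
  by rewrite ler_int; apply: le_floor.
by rewrite /saw; lra.
Qed.

Lemma floor_divz (R : realType) (x : R) (q : nat) : (0 < q)%N ->
  Num.floor (x / q%:R) = (Num.floor x %/ q)%Z.
Proof.
move=> q0; have qR0 : 0 < q%:R :> R by rewrite ltr0n.
apply: floor_def; rewrite ler_pdivlMr// ltr_pdivrMr//.
have -> : q%:R = (q%:Z)%:~R :> R by [].
rewrite -!intrM -floor_ge_int -floor_lt_int.
have q0' : 0 < q%:Z by [].
have := divz_eq (Num.floor x) q; have := ltz_pmod (Num.floor x) q0'.
have := modz_ge0 (Num.floor x) (lt0r_neq0 q0').
move: (Num.floor x) (_ %/ _)%Z (_ %% _)%Z => m d e h1 h2 h3.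
by rewrite mulrDl mul1r; apply/andP; split; lia.
Qed.

Lemma sum_residues (q : nat) (p m : int) : coprimez p q ->
  \sum_(k < q) ((m + p * k%:Z) %% q)%Z = \sum_(k < q) k%:Z.
Proof.
case: q => [|q] cop; first by rewrite !big_ord0.
pose h (k : 'I_q.+1) : 'I_q.+1 := inord `|((m + p * k%:Z) %% q.+1)%Z|%N.
have hE k : (h k)%:Z = ((m + p * k%:Z) %% q.+1)%Z.
  rewrite /h inordK; first by rewrite gez0_abs// modz_ge0.
  by rewrite -ltz_nat gez0_abs ?modz_ge0// ltz_pmod.
rewrite [RHS](reindex_inj (h := h)) /=; first by apply: eq_bigr => k _; rewrite hE.
move=> k l /(congr1 (fun i : 'I_q.+1 => i%:Z)); rewrite !hE => /eqP.
rewrite eqz_mod_dvd (_ : _ - _ = p * (k%:Z - l%:Z)); last by ring.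
rewrite Gauss_dvdzr 1?coprimez_sym// => /dvdzP[t tE].
have := ltn_ord k; have := ltn_ord l => hl hk.
apply: val_inj => /=.
have : (- (q.+1%:Z) < t * q.+1%:Z < q.+1%:Z) by rewrite -tE; lia.
have [t0|[t0|t0]] : t = 0 \/ t <= -1 \/ 1 <= t by lia.
- by move: tE; rewrite t0 mul0r; lia.
- by nia.
- by nia.
Qed.

(** The distribution relation of the sawtooth.  With [m] the floor of [q z], the
    floor of [z + p k / q] is the integer quotient of [m + p k] by [q], and the
    remainders [(m + p k) %% q] run once through [0, ..., q - 1]. *)
Lemma sum_saw_rational (R : realType) (q : nat) (p : int) (z : R) :
  (0 < q)%N -> coprimez p q ->
  \sum_(k < q) saw (z + p%:~R / q%:R * k%:R) = saw (q%:R * z).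
Proof.
move=> q0 cop; have qR0 : q%:R != 0 :> R by rewrite pnatr_eq0 -lt0n.
set m := Num.floor (q%:R * z).
have E (k : 'I_q) : saw (z + p%:~R / q%:R * k%:R) =
    (q%:R * z - m%:~R) / q%:R - 1 / 2
      + ((m + p * k%:Z) %% q)%Z%:~R / q%:R.
  have -> : z + p%:~R / q%:R * k%:R = (q%:R * z + (p * k%:Z)%:~R) / q%:R.
    by rewrite intrM; field.
  rewrite /saw floor_divz// floorDrz ?intr_int// intrKfloor -/m.
  have := divz_eq (m + p * k%:Z) q; move: (_ %/ _)%Z (_ %% _)%Z => d e dE.
  have -> : e%:~R = m%:~R + p%:~R * k%:R - d%:~R * q%:R :> R.
    have -> : e = m + p * k%:Z - d * q%:Z by rewrite dE; ring.
    by rewrite rmorphB rmorphD !rmorphM.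
  by field.
under eq_bigr do rewrite E.
rewrite big_split /= sumr_const card_ord -mulr_suml -(rmorph_sum (intmul 1)).
rewrite sum_residues// rmorph_sum /=.
have -> : \sum_(k < q) k%:Z%:~R = q%:R * (q%:R - 1) / 2 :> R.
  elim: q {q0 cop qR0 m E} => [|q IH]; first by rewrite big_ord0; ring.
  by rewrite big_ord_recr /= IH -natr1 -pmulrn; field.
by rewrite -[(_ - _) *+ q]mulr_natr /saw -/m; field.
Qed.

(** Since the sawtooth only jumps downwards, moving every argument by at most
    [d] can be compared with translating the whole exact progression by [d] or
    by [- d]; its sum is a single sawtooth value whatever the translation.  The
    bound is thus [O(1)] as soon as [d] is [O(1 / q)]. *)
Lemma norm_sum_saw_perturbed (R : realType) (q : nat) (p : int) (z d : R)
    (y : nat -> R) :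
  (0 < q)%N -> coprimez p q ->
  (forall k, (k < q)%N -> `|y k - (z + p%:~R / q%:R * k%:R)| <= d) ->
  `|\sum_(k < q) saw (y k)| <= 2 * d * q%:R + 1 / 2.
Proof.
move=> q0 cop yE.
have up : \sum_(k < q) saw (y k)
    <= \sum_(k < q) (saw (z - d + p%:~R / q%:R * k%:R) + 2 * d).
  apply: ler_sum => k _; have := yE k (ltn_ord k); rewrite ler_norml => /andP[h1 h2].
  apply: le_trans (saw_le_add (x := z - d + p%:~R / q%:R * k%:R) _) _; lra.
have dn : \sum_(k < q) (saw (z + d + p%:~R / q%:R * k%:R) - 2 * d)
    <= \sum_(k < q) saw (y k).
  apply: ler_sum => k _; have := yE k (ltn_ord k); rewrite ler_norml => /andP[h1 h2].
  have := saw_le_add (x := y k) (y := z + d + p%:~R / q%:R * k%:R).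
  move=> /(_ ltac:(lra)); lra.
move: up; rewrite [leRHS]big_split /= sum_saw_rational// sumr_const card_ord.
rewrite -[2 * d *+ q]mulr_natr => up.
move: dn; rewrite big_split /= sum_saw_rational// sumr_const card_ord.
rewrite -[- _ *+ q]mulr_natr mulNr => dn.
have := norm_saw_le (q%:R * (z - d)); have := norm_saw_le (q%:R * (z + d)).
by rewrite !ler_norml => /andP[? ?] /andP[? ?]; apply/andP; split; lra.
Qed.

(** * Rational approximation of the slopes *)

(** Dirichlet's approximation theorem, by the pigeonhole principle on the
    fractional parts of [i a] for [i <= Q]. *)
Lemma dirichlet (R : realType) (a : R) (Q : nat) : (0 < Q)%N ->
  exists q : nat, exists p : int,
    [/\ (0 < q)%N, (q <= Q)%N, coprimez p q & `|q%:R * a - p%:~R| <= Q%:R^-1].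
Proof.
move=> Q0; have QR0 : 0 < Q%:R :> R by rewrite ltr0n.
pose fr (i : nat) : R := i%:R * a - (Num.floor (i%:R * a))%:~R.
have fr0 i : 0 <= fr i < 1.
  have /andP[h1 h2] := floor_itv (i%:R * a); rewrite intrD in h2.
  by rewrite /fr; apply/andP; split; lra.
have box i : (Num.truncn (Q%:R * fr i) < Q)%N.
  have /andP[h1 h2] := fr0 i.
  by rewrite truncn_lt_nat; [nra|rewrite mulr_ge0// ltW].
pose F (i : 'I_Q.+1) : 'I_Q := Ordinal (box i).
have /injectivePn[i [j ij Fij]] : ~~ injectiveb F.
  apply/negP => /injectiveP /leq_card; rewrite !card_ord; lia.
have close (k l : nat) : Num.truncn (Q%:R * fr k) = Num.truncn (Q%:R * fr l) ->
    fr k - fr l <= Q%:R^-1.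
  move=> kl; have /andP[k0 k1] := fr0 k; have /andP[l0 l1] := fr0 l.
  have /andP[_ h1] := truncn_itv (mulr_ge0 (ltW QR0) k0).
  have /andP[h2 _] := truncn_itv (mulr_ge0 (ltW QR0) l0).
  rewrite -[leRHS]div1r ler_pdivlMr//.
  move: h1 h2; rewrite kl -natr1; lra.
wlog ltij : i j ij Fij / (i < j)%N => [W|].
  have : (i : nat) != j by []. rewrite neq_ltn => /orP[h|h]; first exact: (W i j).
  by apply: (W j i) => //; rewrite eq_sym.
have /(congr1 val) /= Fij' := Fij.
pose q := (j - i)%N; pose p := Num.floor (j%:R * a) - Num.floor (i%:R * a).
have q0 : (0 < q)%N by rewrite subn_gt0.
have qQ : (q <= Q)%N by have := ltn_ord j; rewrite /q; lia.
have qp : `|q%:R * a - p%:~R| <= Q%:R^-1.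
  have -> : q%:R * a - p%:~R = fr j - fr i.
    by rewrite /q /p /fr natrB 1?ltnW// intrB; ring.
  rewrite ler_norml close ?andbT//.
  have := close _ _ Fij'; lra.
(* dividing p and q by their gcd only improves the approximation *)
have g0 : (0 < gcdn `|p| q)%N by rewrite gcdn_gt0 q0 orbT.
set g := gcdn `|p| q in g0 *.
have gR : 1 <= g%:R :> R by rewrite ler1n.
have [q' qE] : exists q', q = (q' * g)%N by apply/dvdnP; rewrite dvdn_gcdr.
have [p' pE] : exists p', p = p' * g%:Z.
  by apply/dvdzP; rewrite dvdzE /= dvdn_gcdl.
exists q', p'; split.
- by move: q0; rewrite qE muln_gt0 => /andP[].
- by apply: leq_trans qQ; rewrite qE leq_pmulr.
- rewrite coprimezE /coprime -(eqn_pmul2r g0) mul1n.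
  by rewrite muln_gcdl -qE -[X in (_ * X)%N]/(`|g%:Z|%N) -abszM -pE.
- apply: le_trans qp.
  have -> : q%:R * a - p%:~R = (q'%:R * a - p'%:~R) * g%:R.
    by rewrite qE pE natrM intrM; ring.
  by rewrite normrM ler_peMr// ger0_norm// ltW// (lt_le_trans ltr01).
Qed.

(** The hits lie between the first one, [m], and [m + 2 e / c], because [b] moves
    by at least [c] per step and two hits differ by at most [2 e]. *)
Lemma count_separated (R : realType) (b : nat -> R) (c v e : R) (M : nat) :
  0 < c -> 0 <= e ->
  (forall n k, (n + k < M)%N -> c * k%:R <= `|b (n + k)%N - b n|) ->
  \sum_(0 <= n < M) (`|b n - v| <= e)%R%:R <= 2 * e / c + 1.
Proof.
move=> c0 e0 sep; pose P n := `|b n - v| <= e.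
have ec0 : 0 <= 2 * e / c by rewrite divr_ge0 ?mulr_ge0// ltW.
rewrite -natr_sum -/P.
have -> : (\sum_(0 <= n < M) (P n : nat))%N = size [seq n <- index_iota 0 M | P n].
  by rewrite size_filter -sum1_count [RHS]big_mkcond /=; apply: eq_bigr => n _; case: (P n).
case: (boolP (has P (index_iota 0 M))) => [/hasP ex|]; last first.
  by rewrite has_filter negbK => /eqP -> /=; lra.
have [m [mM Pm mmin]] : exists m, [/\ (m < M)%N, P m & forall n, P n -> (n < M)%N -> (m <= n)%N].
  have ex' : exists n, (n < M)%N && P n.
    by case: ex => n; rewrite mem_index_iota => /andP[_ nM] Pn; exists n; rewrite nM.
  case: (ex_minnP ex') => m /andP[mM Pm] mmin; exists m; split=> // n Pn nM.
  by apply: mmin; rewrite nM.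
set D := Num.truncn (2 * e / c).
have sub : {subset [seq n <- index_iota 0 M | P n] <= iota m D.+1}.
  move=> n; rewrite mem_filter mem_index_iota mem_iota => /andP[Pn nM].
  have mn := mmin n Pn nM; rewrite mn /= addnS ltnS -leq_subLR.
  rewrite truncn_ge_nat// ler_pdivlMr// mulrC.
  have := sep m (n - m)%N; rewrite subnKC// => /(_ nM) h; apply: le_trans h _.
  move: Pn Pm; rewrite /P !ler_norml => /andP[? ?] /andP[? ?].
  by apply/andP; split; lra.
have := uniq_leq_size (filter_uniq P (iota_uniq _ _)) sub.
rewrite size_iota -(ler_nat R) => h; apply: le_trans h _.
rewrite -natr1 lerD2r; have /andP[//] := truncn_itv ec0.
Qed.

(** A majorant of the indicator that [b] is close to a fraction of denominator at
    most [K].  Summing over the fractions, with multiplicity, lets the sum over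
    a sequence of slopes be exchanged with the sum over fractions.  The index
    [i] stands for the signed numerator [i - B]. *)
Definition rational_weight (R : realType) (K B : nat) (e b : R) : R :=
  \sum_(q < K) \sum_(i < (2 * B).+1)
    (`|q.+1%:R * b - (i%:R - B%:R)| <= e)%R%:R.

Lemma rational_weight_ge0 (R : realType) (K B : nat) (e b : R) :
  0 <= rational_weight K B e b.
Proof. by apply: sumr_ge0 => q _; apply: sumr_ge0 => i _; rewrite ler0n. Qed.

Lemma rational_weight_ge1 (R : realType) (K B : nat) (e b : R) (q : nat) (p : int) :
  (0 < q <= K)%N -> (`|p| <= B)%N -> `|q%:R * b - p%:~R| <= e ->
  1 <= rational_weight K B e b.
Proof.
move=> /andP[q0 qK] pB pe.
have q1K : (q.-1 < K)%N by lia.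
pose j := absz (p + B%:Z).
have iB : (j < (2 * B).+1)%N by lia.
rewrite /rational_weight (bigD1 (Ordinal q1K)) //= (bigD1 (Ordinal iB)) //=.
have -> : j%:R - B%:R = p%:~R :> R.
  have -> : j%:R = (p + B%:Z)%:~R :> R.
    by rewrite /j -[in RHS](@gez0_abs (p + B%:Z)) //; lia.
  by rewrite intrD; ring.
rewrite prednK// pe -addrA lerDl addr_ge0//.
  by apply: sumr_ge0 => i _; rewrite ler0n.
by apply: sumr_ge0 => k _; apply: sumr_ge0 => i _; rewrite ler0n.
Qed.

Lemma sum_rational_weight_le (R : realType) (b : nat -> R) (c e : R) (K B M : nat) :
  0 < c -> 0 <= e ->
  (forall n k, (n + k < M)%N -> c * k%:R <= `|b (n + k)%N - b n|) ->
  \sum_(0 <= n < M) rational_weight K B e (b n)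
    <= (K * (2 * B).+1)%:R * (2 * e / c + 1).
Proof.
move=> c0 e0 sep; rewrite /rational_weight exchange_big /=.
rewrite natrM -mulrA -[K in leRHS]card_ord mulrC mulr_natr -sumr_const.
apply: ler_sum => q _; rewrite exchange_big /=.
rewrite -[(2 * B).+1 in leRHS]card_ord mulrC mulr_natr -sumr_const.
apply: ler_sum => i _; apply: (count_separated (b := fun n => q.+1%:R * b n)) => //.
move=> n k nk; rewrite -mulrBr normrM ger0_norm//.
by apply: le_trans (sep n k nk) _; rewrite ler_peMl// ler1n.
Qed.

(** Starting from any [n], the denominator [q] of a Dirichlet approximation of the
    slope [b n] is a good block length: over [q] steps [u] stays within [2 / Q]
    of the progression of ratio [p / q].  If [q > K] the block sum is [O(1)],
    hence at most [eps q]; if [q <= K] all slopes of the block are close to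
    [p / q], and the weight, which is at least 1 there, dominates the trivial
    bound. *)
Lemma sum_saw_block (R : realType) (P kap eps c : R) (K B Q M n : nat)
    (u b : nat -> R) :
  0 <= eps -> 5 <= eps * K%:R -> K%:R * P + 1 <= B%:R -> (0 < Q)%N ->
  0 <= c -> 0 <= kap -> kap * c * Q%:R ^+ 3 <= 1 ->
  (forall m, (m < M)%N -> `|b m| <= P) ->
  (forall m k, (m + k < M)%N ->
     `|u (m + k)%N - u m - b m * k%:R| <= kap * c * k%:R ^+ 2) ->
  (forall m k, (m + k < M)%N -> `|b (m + k)%N - b m| <= kap * c * k%:R) ->
  (n + Q <= M)%N ->
  exists q, (0 < q <= Q)%N /\
    `|\sum_(n <= i < n + q) saw (u i)|
       <= \sum_(n <= i < n + q) (eps + rational_weight K B (2 / Q%:R) (b i)).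
Proof.
move=> eps0 epsK PB Q0 c0 kap0 cQ bP ub bb nQ.
have [q [p [q0 qQ cop qp]]] := dirichlet (b n) Q0.
exists q; split; first by rewrite q0 qQ.
have kM k : (k < q)%N -> (n + k < M)%N.
  by move=> kq; apply: leq_trans nQ; rewrite ltn_add2l (leq_trans kq).
have nM : (n < M)%N by have := kM 0%N q0; rewrite addn0.
have QR0 : 0 < Q%:R :> R by rewrite ltr0n.
have qR0 : 0 < q%:R :> R by rewrite ltr0n.
have qQR : q%:R <= Q%:R :> R by rewrite ler_nat.
have Q1 : 1 <= Q%:R :> R by rewrite ler1n.
have cQ2 : kap * c * Q%:R ^+ 2 <= Q%:R^-1.
  by rewrite -[leRHS]div1r ler_pdivlMr//; lra.
have kc0 : 0 <= kap * c by rewrite mulr_ge0.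
have le_sq (x y : R) : 0 <= x <= Q%:R -> 0 <= y <= Q%:R ->
    kap * c * (x * y) <= Q%:R^-1.
  move=> /andP[? ?] /andP[? ?]; apply: le_trans cQ2; apply: ler_wpM2l => //.
  by rewrite expr2; apply: ler_pM.
have kb (k : nat) : (k < q)%N -> (0 <= (k%:R : R) <= Q%:R) && ((k%:R : R) <= q%:R).
  move=> kq; have : k%:R <= q%:R :> R by rewrite ler_nat ltnW.
  by rewrite ler0n /= => h; rewrite h (le_trans h qQR).
have shift (F : nat -> R) : \sum_(n <= i < n + q) F i = \sum_(k < q) F (n + k)%N.
  rewrite -{1}[n]add0n big_addn addKn big_mkord.
  by apply: eq_bigr => k _; rewrite addnC.
rewrite !shift; have [qK|Kq] := leqP q K.
- (* small denominator: every slope in the block is near p / q *)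
  apply: le_trans (ler_norm_sum _ _ _) _; apply: ler_sum => k _.
  have /andP[/andP[k0 kQ] kq] := kb k (ltn_ord k).
  have nkM := kM k (ltn_ord k).
  apply: (@le_trans _ _ 1); first by have := norm_saw_le (u (n + k)%N); lra.
  apply: (@le_trans _ _ (0 + rational_weight K B (2 / Q%:R) (b (n + k)%N))); last first.
    by rewrite lerD2r.
  rewrite add0r; apply: (rational_weight_ge1 (q := q) (p := p)); first by rewrite q0 qK.
    have : `|p%:~R| <= q%:R * `|b n| + 1 :> R.
      rewrite -[q%:R in leRHS]ger0_norm ?ler0n// -normrM.
      have := ler_norm (p%:~R - q%:R * b n).
      have : Q%:R^-1 <= 1 :> R by rewrite invf_le1.
      rewrite distrC in qp => h1 h2.
      have := ler_normB (p%:~R - q%:R * b n) (- (q%:R * b n)).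
      rewrite opprK subrK normrN; lra.
    have qb : q%:R * `|b n| <= K%:R * P.
      by apply: ler_pM; rewrite ?ler0n ?ler_nat ?normr_ge0 ?bP.
    by move=> h; rewrite -(ler_nat R) natr_absz intr_norm; lra.
  have -> : q%:R * b (n + k)%N - p%:~R =
    (q%:R * b n - p%:~R) + q%:R * (b (n + k)%N - b n) by ring.
  apply: le_trans (ler_normD _ _) _; rewrite normrM (ger0_norm (ler0n _ _)).
  have := le_sq q%:R k%:R _ _; rewrite k0 kQ qQR ler0n => /(_ isT isT).
  have := bb n k nkM => /(ler_wpM2l (ltW qR0)); lra.
(* large denominator: the block is a perturbed complete progression mod q *)
apply: (@le_trans _ _ (2 * (2 / Q%:R) * q%:R + 1 / 2)).
  apply: (norm_sum_saw_perturbed (p := p) (z := u n) (y := fun k => u (n + k)%N)) => // k kq.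
  have /andP[/andP[k0 kQ] kq'] := kb k kq.
  have nkM := kM k kq.
  have -> : u (n + k)%N - (u n + p%:~R / q%:R * k%:R) =
     (u (n + k)%N - u n - b n * k%:R) + (q%:R * b n - p%:~R) * (k%:R / q%:R).
    by field; rewrite gt_eqF.
  apply: le_trans (ler_normD _ _) _; rewrite normrM.
  have kq1 : 0 <= (k%:R / q%:R : R) <= 1.
    by rewrite divr_ge0//= ler_pdivrMr// mul1r.
  have /andP[kq10 kq11] := kq1.
  rewrite (ger0_norm kq10).
  have := le_sq k%:R k%:R _ _; rewrite k0 kQ => /(_ isT isT).
  have := ub n k nkM; rewrite expr2.
  have : `|q%:R * b n - p%:~R| * (k%:R / q%:R) <= Q%:R^-1 * 1 by apply: ler_pM.
  lra.
apply: (@le_trans _ _ (\sum_(k < q) eps)); last first.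
  by apply: ler_sum => k _; rewrite lerDl rational_weight_ge0.
rewrite sumr_const card_ord -[eps *+ q]mulr_natr.
have : eps * K%:R <= eps * q%:R by apply: ler_wpM2l => //; rewrite ler_nat ltnW.
have : Q%:R^-1 * q%:R <= 1 :> R by rewrite mulrC ler_pdivrMr// mul1r.
lra.
Qed.

(** Blocks are consumed one after the other until fewer than [Q] terms remain;
    these are estimated trivially. *)
Lemma sum_greedy_blocks (R : realType) (g W : nat -> R) (Q M : nat) :
  (forall n, `|g n| <= 1) -> (forall n, 0 <= W n) ->
  (forall n, (n + Q <= M)%N -> exists q, (0 < q <= Q)%N /\
     `|\sum_(n <= i < n + q) g i| <= \sum_(n <= i < n + q) W i) ->
  `|\sum_(0 <= i < M) g i| <= \sum_(0 <= i < M) W i + Q%:R.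
Proof.
move=> g1 W0 block.
suff: forall d n, (M - n <= d)%N -> (n <= M)%N ->
    `|\sum_(n <= i < M) g i| <= \sum_(n <= i < M) W i + Q%:R.
  by move=> /(_ M 0%N); apply; rewrite ?subn0.
elim=> [|d IH] n dn nM.
  have -> : n = M by lia.
  by rewrite !big_geq// normr0 add0r.
have [short|long] := ltnP M (n + Q).
  apply: (@le_trans _ _ Q%:R); last by rewrite lerDr sumr_ge0.
  apply: le_trans (ler_norm_sum _ _ _) _.
  apply: (@le_trans _ _ (\sum_(n <= i < M) 1)); first exact: ler_sum.
  by rewrite sumr_const_nat ler_nat; lia.
have [q [/andP[q0 qQ] hq]] := block n long.
rewrite !(@big_cat_nat _ _ _ (n + q) n M) /=; try lia.
apply: le_trans (ler_normD _ _) _; rewrite -addrA; apply: lerD => //.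
by apply: IH; lia.
Qed.

(** * Cancellation when the slope turns slowly *)

(** Van der Corput's principle, with an unquantified saving: if the slope [b] of
    [u] turns by an amount comparable to [c] per step, the sawtooth sums cancel
    as [c] tends to 0.  The slope spends a proportion [O(1 / Q)] of the
    [1 / c] steps it needs to move by 1 near each of the boundedly many fractions of
    denominator at most [K], so that [Q] is chosen last, after [K] (given by
    [eps]) and the range [B] of the numerators (given by [K] and [P]). *)
Lemma sum_saw_slowly_turning (R : realType) (P kap eps : R) :
  0 <= P -> 0 <= kap -> 0 < eps ->
  exists2 c0 : R, 0 < c0 & forall (c : R) (M : nat) (u b : nat -> R),
  0 < c <= c0 ->
  (forall n, (n < M)%N -> `|b n| <= P) ->
  (forall n k, (n + k < M)%N ->
     `|u (n + k)%N - u n - b n * k%:R| <= kap * c * k%:R ^+ 2) ->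
  (forall n k, (n + k < M)%N ->
     c * k%:R <= `|b (n + k)%N - b n| <= kap * c * k%:R) ->
  `|\sum_(0 <= n < M) saw (u n)| <= eps * (M%:R + 1 / c).
Proof.
move=> P0 kap0 eps0.
pose K := (Num.truncn (5 / eps)).+1.
have epsK : 5 <= eps * K%:R.
  by rewrite mulrC -ler_pdivrMr// ltW// truncnS_gt.
pose B := (Num.truncn (K%:R * P + 1)).+1.
have PB : K%:R * P + 1 <= B%:R by rewrite ltW// truncnS_gt.
pose T := (K * (2 * B).+1)%N.
pose Q := (Num.truncn (8 * T%:R / eps)).+1.
have QR0 : 0 < Q%:R :> R by rewrite ltr0n.
have QT : 8 * T%:R <= eps * Q%:R.
  by rewrite mulrC (mulrC eps) -ler_pdivrMr// mulrC ltW// truncnS_gt.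
have TQ0 : 0 < (T + Q)%:R :> R by rewrite ltr0n addn_gt0 orbT.
have kQ0 : 0 < (kap + 1) * Q%:R ^+ 3 by rewrite mulr_gt0 ?exprn_gt0//; lra.
(* the first bound makes the curvature negligible over a block, the second
   absorbs the terms that do not depend on M and c *)
exists (Num.min ((kap + 1) * Q%:R ^+ 3)^-1 (eps / (2 * (T + Q)%:R))).
  by rewrite lt_min invr_gt0 kQ0 divr_gt0// mulr_gt0.
move=> c M u b /andP[c0]; rewrite le_min => /andP[cQ cTQ] bP ub bb.
have cQ3 : kap * c * Q%:R ^+ 3 <= 1.
  move: cQ; rewrite -[leRHS]div1r ler_pdivlMr// => h; apply: le_trans h.
  rewrite mulrAC [leRHS]mulrC; apply: ler_wpM2r; first exact: ltW.
  by rewrite ler_wpM2r ?exprn_ge0//; lra.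
have e0 : 0 <= 2 / Q%:R :> R by rewrite divr_ge0.
have blk n : (n + Q <= M)%N -> exists q, (0 < q <= Q)%N /\
    `|\sum_(n <= i < n + q) saw (u i)|
       <= \sum_(n <= i < n + q) (eps + rational_weight K B (2 / Q%:R) (b i)).
  apply: (sum_saw_block (P := P) (kap := kap) (c := c)) => //; try exact: ltW.
  by move=> m k /bb /andP[].
have := sum_greedy_blocks _ _ blk.
move=> /(_ (fun n => le_trans (norm_saw_le _) _)).
move=> /(_ ltac:(lra)) /(_ (fun n => addr_ge0 (ltW eps0) (rational_weight_ge0 _ _ _ _))) h.
apply: le_trans h _; rewrite big_split /= sumr_const_nat subn0 -[eps *+ M]mulr_natr.
have wle : \sum_(0 <= i < M) rational_weight K B (2 / Q%:R) (b i)
    <= T%:R * (2 * (2 / Q%:R) / c + 1).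
  by apply: sum_rational_weight_le => // n k /bb /andP[].
have h1 : T%:R * (2 * (2 / Q%:R) / c) <= eps / 2 / c.
  rewrite mulrA ler_pM2r ?invr_gt0// !mulrA ler_pdivrMr//; lra.
have h2 : T%:R + Q%:R <= eps / 2 / c.
  rewrite -natrD ler_pdivlMr// mulrC ler_pdivlMr// .
  by move: cTQ; rewrite ler_pdivlMr ?mulr_gt0//; lra.
rewrite [1 / c]div1r; lra.
Qed.

(** * The area under an arc of circle *)

Definition circ (R : realType) (r x : R) : R := Num.sqrt (r ^+ 2 - x ^+ 2).

(** The area under the circle of radius [r] between the abscissas 0 and [x]: a
    circular sector plus a right triangle. *)
Definition circ_area (R : realType) (r x : R) : R :=
  (r ^+ 2 * asin (x / r) + x * circ r x) / 2.

Lemma circ_sin (R : realType) (r t : R) :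
  0 <= r -> - (pi / 2) <= t <= pi / 2 -> circ r (r * sin t) = r * cos t.
Proof.
move=> r0 /cos_ge0_pihalf c0; rewrite /circ exprMn -{1}[r ^+ 2]mulr1 -mulrBr.
by rewrite -cos2sin2 -exprMn sqrtr_sqr ger0_norm// mulr_ge0.
Qed.

Lemma circ_area_sin (R : realType) (r t : R) :
  0 < r -> - (pi / 2) <= t <= pi / 2 ->
  circ_area r (r * sin t) = r ^+ 2 / 2 * (t + sin t * cos t).
Proof.
move=> r0 tb; rewrite /circ_area circ_sin ?(ltW r0)//.
have -> : r * sin t / r = sin t by field; rewrite gt_eqF.
by rewrite sinK ?in_itv//; field.
Qed.

(** Mean value comparison of the area under the arc with the area under the line
    of value [al] at [x] and slope [be].  In the angular variable everything is
    smooth up to the end points, so [y = r], where the circle has a vertical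
    tangent, is allowed. The factor [k] is nonnegative because the abscissa
    increases with the angle. *)
Lemma circ_area_chord (R : realType) (r x y al be : R) :
  0 < r -> - r <= x <= y -> y <= r ->
  exists t k, [/\ x <= t <= y, 0 <= k &
    circ_area r y - circ_area r x - (al * (y - x) + be * (y - x) ^+ 2 / 2)
      = k * (circ r t - (al + be * (t - x)))].
Proof.
move=> r0 /andP[rx xy] yr.
have ang z : - r <= z <= r -> exists2 t, - (pi / 2) <= t <= pi / 2 & z = r * sin t.
  move=> /andP[rz zr].
  have zb : -1 <= z / r <= 1.
    by rewrite ler_pdivlMr// ler_pdivrMr// mulN1r mul1r rz.
  exists (asin (z / r)); first by have [] := asin_def zb.
  by rewrite asinK ?in_itv// mulrC divfK ?gt_eqF.
have [a ab xE] : exists2 t, - (pi / 2) <= t <= pi / 2 & x = r * sin t.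
  by apply: ang; rewrite rx (le_trans xy).
have [b bb yE] : exists2 t, - (pi / 2) <= t <= pi / 2 & y = r * sin t.
  by apply: ang; rewrite yr (le_trans rx).
have sin_le (u v : R) : - (pi / 2) <= u <= pi / 2 -> - (pi / 2) <= v <= pi / 2 ->
    (r * sin u <= r * sin v) = (u <= v).
  by move=> ub vb; rewrite ler_pM2l// !leNgt ltr_sin ?in_itv.
have ableq : a <= b by rewrite -sin_le// -xE -yE.
pose F : R -> R := (r ^+ 2 / 2) *: (id + @sin R * @cos R) - (al * r) *: @sin R
  - (be / 2) *: (r *: @sin R - cst x) ^+ 2.
pose dF t := r * cos t * (r * cos t - (al + be * (r * sin t - x))).
have Fd (t : R) : is_derive t 1 F (dF t).
  apply: is_derive_eq.
  have -> : (r *: @sin R - cst x) t = r * sin t - x by [].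
  rewrite /dF /GRing.scale /=.
  have := cos2sin2 t; set C := cos t; set S := sin t => CS.
  have -> : S * - S = C ^+ 2 - 1 by rewrite CS; ring.
  by field.
have Fc : {within `[a, b], continuous F}.
  by apply: derivable_within_continuous => t _; exact: ex_derive.
have [t /itvP tab FE] := MVT_segment ableq (fun t _ => Fd t) Fc.
have tb : - (pi / 2) <= t <= pi / 2.
  move: ab bb => /andP[a1 a2] /andP[b1 b2].
  by rewrite (le_trans a1) ?tab// (le_trans _ b2) ?tab.
exists (r * sin t), (r * cos t * (b - a)); split.
- by rewrite xE yE !sin_le// !tab.
- by rewrite mulr_ge0 ?subr_ge0// mulr_ge0 ?cos_ge0_pihalf// ltW.
rewrite circ_sin ?(ltW r0)//.
transitivity (F b - F a); last by rewrite FE /dF; ring.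
rewrite [in circ_area r x]xE yE !circ_area_sin//.
have Fz z : F z = r ^+ 2 / 2 * (z + sin z * cos z) - al * r * sin z
    - be / 2 * (r * sin z - x) ^+ 2 by [].
by rewrite !Fz xE; field.
Qed.

Lemma circ_sqr (R : realType) (r x : R) :
  0 <= x <= r -> circ r x ^+ 2 = r ^+ 2 - x ^+ 2.
Proof.
by move=> /andP[x0 xr]; rewrite sqr_sqrtr// subr_ge0 lerXn2r ?nnegrE// (le_trans x0).
Qed.

Lemma le_circ (R : realType) (r x y : R) : 0 <= x <= y -> circ r y <= circ r x.
Proof.
move=> /andP[x0 xy]; apply: ler_wsqrtr.
by rewrite lerD2l lerN2 lerXn2r ?nnegrE// (le_trans x0).
Qed.

Lemma circ_le_radius (R : realType) (r x : R) : 0 <= r -> circ r x <= r.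
Proof.
move=> r0; rewrite -[leRHS](ger0_norm r0) -sqrtr_sqr; apply: ler_wsqrtr.
by rewrite gerBl sqr_ge0.
Qed.

Lemma circ_gt0_lt (R : realType) (r x : R) : 0 <= r -> 0 <= x -> 0 < circ r x -> x < r.
Proof.
by move=> r0 x0; rewrite sqrtr_gt0 subr_gt0 ltr_pXn2r.
Qed.

(** * The arc away from its vertical tangent *)

(** Throughout, the ordinates on the arc from [x] to [y] are at least [sg r]; on
    such an arc the slope [x / circ r x] is bounded and turns at a rate
    comparable to [1 / r]. *)
Section ArcAwayFromEnd.
Context (R : realType) (sg r x y : R) (sg0 : 0 < sg) (sg1 : sg <= 1) (r0 : 0 < r)
  (x0 : 0 <= x) (xy : x <= y) (ysg : sg * r <= circ r y).

Let sgr0 : 0 < sg * r. Proof. by rewrite mulr_gt0. Qed.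
Let Y0 : 0 < circ r y. Proof. exact: lt_le_trans ysg. Qed.
Let yr : y <= r.
Proof. by rewrite ltW// circ_gt0_lt ?(ltW r0)// (le_trans x0). Qed.
Let YX : circ r y <= circ r x. Proof. by apply: le_circ; rewrite x0. Qed.
Let X0 : 0 < circ r x. Proof. exact: lt_le_trans YX. Qed.
Let X2 : circ r x ^+ 2 = r ^+ 2 - x ^+ 2.
Proof. by rewrite circ_sqr// x0 (le_trans xy). Qed.
Let Y2 : circ r y ^+ 2 = r ^+ 2 - y ^+ 2.
Proof. by rewrite circ_sqr// yr (le_trans x0). Qed.
Let Xr : circ r x <= r. Proof. by rewrite circ_le_radius// ltW. Qed.
Let Yr : circ r y <= r. Proof. by rewrite circ_le_radius// ltW. Qed.

(* Both the deviation from the tangent and the variation of the slope are W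
   divided by a product of ordinates. *)
Let W := y * circ r x - x * circ r y.

Let W_ge : (y - x) * circ r x <= W.
Proof. by rewrite /W; have := ler_wpM2l x0 YX; lra. Qed.

Let W_le : W <= (y - x) * (2 * r / sg).
Proof.
have dXY : circ r x - circ r y <= (y - x) / sg.
  rewrite ler_pdivlMr//.
  have d0 : 0 <= circ r x - circ r y by rewrite subr_ge0.
  have h1 : (circ r x - circ r y) * (circ r x + circ r y) = (y - x) * (x + y).
    by rewrite -subr_sqr X2 Y2; ring.
  have h2 : (circ r x - circ r y) * (2 * (sg * r))
      <= (circ r x - circ r y) * (circ r x + circ r y).
    by apply: ler_wpM2l => //; have := YX; have := ysg; lra.
  have h3 : (y - x) * (x + y) <= (y - x) * (2 * r).
    by apply: ler_wpM2l; have := yr; have := xy; lra.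
  rewrite -(ler_pM2r (_ : 0 < 2 * r)); first by lra.
  by rewrite mulr_gt0.
have h4 : x * (circ r x - circ r y) <= r * ((y - x) / sg).
  by apply: ler_pM => //; [rewrite subr_ge0|rewrite (le_trans xy)].
have h5 : (y - x) * circ r x <= (y - x) * (r / sg).
  apply: ler_wpM2l; first by rewrite subr_ge0.
  by apply: le_trans Xr _; rewrite ler_pdivlMr// ler_piMr// ltW.
have -> : (y - x) * (2 * r / sg) = r * ((y - x) / sg) + (y - x) * (r / sg) by ring.
by rewrite /W; lra.
Qed.

Lemma circ_tangent :
  0 <= circ r x - circ r y - x / circ r x * (y - x)
    <= (y - x) ^+ 2 / (sg ^+ 3 * r).
Proof.
have E : circ r x - circ r y - x / circ r x * (y - x) =
    (y - x) * W / (circ r x * (circ r x + circ r y)).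
  have -> : circ r x - circ r y = (y ^+ 2 - x ^+ 2) / (circ r x + circ r y).
    have -> : y ^+ 2 - x ^+ 2 = circ r x ^+ 2 - circ r y ^+ 2 by rewrite X2 Y2; ring.
    by field; rewrite gt_eqF// addr_gt0.
  by rewrite /W; field; rewrite !gt_eqF// addr_gt0.
rewrite E; have yx0 : 0 <= y - x by rewrite subr_ge0.
have W0 : 0 <= W by apply: le_trans W_ge; rewrite mulr_ge0// ltW.
have D0 : 0 < circ r x * (circ r x + circ r y) by rewrite mulr_gt0// addr_gt0.
rewrite divr_ge0 ?(ltW D0) ?mulr_ge0//=.
rewrite ler_pdivrMr//.
have -> : (y - x) ^+ 2 / (sg ^+ 3 * r) * (circ r x * (circ r x + circ r y)) =
   (y - x) * ((y - x) / (sg ^+ 3 * r) * (circ r x * (circ r x + circ r y))) by ring.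
apply: ler_wpM2l => //; apply: le_trans W_le _.
have -> : (y - x) * (2 * r / sg) = (y - x) / (sg ^+ 3 * r) * ((sg * r) * (2 * (sg * r))).
  by field; rewrite !gt_eqF.
apply: ler_wpM2l; first by rewrite divr_ge0// mulr_ge0 ?exprn_ge0// ltW.
by apply: ler_pM; have := ysg; have := YX; have := sgr0; lra.
Qed.

Lemma circ_slope_diff :
  (y - x) / r <= y / circ r y - x / circ r x <= 2 * (y - x) / (sg ^+ 3 * r).
Proof.
have E : y / circ r y - x / circ r x = W / (circ r x * circ r y).
  by rewrite /W; field; rewrite !gt_eqF.
rewrite E; have yx0 : 0 <= y - x by rewrite subr_ge0.
apply/andP; split.
  rewrite ler_pdivlMr ?mulr_gt0//; apply: le_trans W_ge.
  have -> : (y - x) / r * (circ r x * circ r y) = (y - x) * circ r x * (circ r y / r).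
    by ring.
  by rewrite ler_piMr ?mulr_ge0 ?(ltW X0)// ler_pdivrMr// mul1r.
rewrite ler_pdivrMr ?mulr_gt0//; apply: le_trans W_le _.
have -> : (y - x) * (2 * r / sg) = 2 * (y - x) / (sg ^+ 3 * r) * ((sg * r) * (sg * r)).
  by field; rewrite !gt_eqF.
apply: ler_wpM2l; last by apply: ler_pM; have := ysg; have := YX; have := sgr0; lra.
by rewrite divr_ge0 ?mulr_ge0 ?exprn_ge0 ?(ltW sg0) ?(ltW r0).
Qed.

Lemma circ_slope_le : 0 <= y / circ r y <= sg^-1.
Proof.
rewrite divr_ge0 ?(ltW Y0) ?(le_trans x0)//= ler_pdivrMr//.
by rewrite mulrC ler_pdivlMr// mulrC; apply: le_trans ysg; apply: ler_wpM2l => //; exact: ltW.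
Qed.

End ArcAwayFromEnd.

(** The tangent at [x] approximates both the arc and its chord up to
    [O(1 / r)], hence also the area of the trapezoid. *)
Lemma circ_area_trapezoid (R : realType) (sg r x : R) :
  0 < sg <= 1 -> 0 < r -> 0 <= x -> sg * r <= circ r (x + 1) ->
  `|circ_area r (x + 1) - circ_area r x - (circ r x + circ r (x + 1)) / 2|
    <= 2 / (sg ^+ 3 * r).
Proof.
move=> /andP[sg0 sg1] r0 x0 xsg.
set e := (sg ^+ 3 * r)^-1; have e0 : 0 < e by rewrite invr_gt0 mulr_gt0 ?exprn_gt0.
have x1r : x + 1 <= r.
  by rewrite ltW// circ_gt0_lt ?(ltW r0)//; [lra|rewrite (lt_le_trans _ xsg)// mulr_gt0].
have tan t : x <= t <= x + 1 ->
    0 <= circ r x - circ r t - x / circ r x * (t - x) <= e.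
  move=> /andP[xt tx1].
  have tsg : sg * r <= circ r t.
    by apply: le_trans xsg _; apply: le_circ; rewrite (le_trans x0).
  have /andP[-> h] /= := circ_tangent sg0 sg1 r0 x0 xt tsg.
  apply: le_trans h _; rewrite ler_piMl// ?(ltW e0)//.
  rewrite expr_le1//; lra.
have chord al be := @circ_area_chord R r x (x + 1) al be r0.
have rx : - r <= x <= x + 1 by apply/andP; split; lra.
have := tan (x + 1); rewrite lexx lerDl ler01 => /(_ isT).
set b := x / circ r x in tan *.
rewrite (_ : x + 1 - x = 1); last by ring.
rewrite mulr1 => /andP[t1 t2].
have [u [k [uI k0]]] := chord (circ r x) (- b) rx x1r.
have [v [l [vI l0]]] := chord (circ r x - e) (- b) rx x1r.
rewrite (_ : x + 1 - x = 1); last by ring.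
rewrite expr1n !mulr1 => hl hk.
have ku : 0 <= k * (circ r x - circ r u - b * (u - x)).
  by rewrite mulr_ge0//; have /andP[] := tan u uI.
have lv : 0 <= l * (e - (circ r x - circ r v - b * (v - x))).
  by rewrite mulr_ge0// subr_ge0; have /andP[] := tan v vI.
rewrite ler_norml; apply/andP; split; lra.
Qed.

(** * Summing over the integers of the radius *)

Lemma circ_ge_interior (R : realType) (sg r x : R) :
  0 < sg <= 1 / 2 -> 0 < r -> 0 <= x <= (1 - sg ^+ 2) * r -> sg * r <= circ r x.
Proof.
move=> /andP[sg0 sg1] r0 /andP[x0 xr].
have sgr0 : 0 <= sg * r by rewrite mulr_ge0// ltW.
rewrite -(ger0_norm sgr0) -sqrtr_sqr; apply: ler_wsqrtr.
have : x ^+ 2 <= ((1 - sg ^+ 2) * r) ^+ 2 by rewrite lerXn2r ?nnegrE// (le_trans x0).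
have : 0 <= r ^+ 2 * (sg ^+ 2 * (1 - sg ^+ 2)).
  by rewrite mulr_ge0 ?sqr_ge0// mulr_ge0 ?sqr_ge0//; nra.
lra.
Qed.

Lemma circ_le_boundary (R : realType) (sg r x : R) :
  0 < sg <= 1 / 2 -> 2 / sg ^+ 2 <= r -> (1 - sg ^+ 2) * r - 1 <= x ->
  circ r x <= 2 * sg * r.
Proof.
move=> /andP[sg0 sg1] rsg xr.
have sg2 : 0 < sg ^+ 2 by rewrite exprn_gt0.
have sg24 : sg ^+ 2 <= 1 / 4 by nra.
move: rsg; rewrite ler_pdivrMr// => rsg.
have r8 : 8 <= r by nra.
have b0 : 0 <= 2 * sg * r by rewrite !mulr_ge0//; lra.
rewrite -(ger0_norm b0) -sqrtr_sqr; apply: ler_wsqrtr.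
have y0 : 0 <= (1 - sg ^+ 2) * r - 1 by nra.
have : ((1 - sg ^+ 2) * r - 1) ^+ 2 <= x ^+ 2 by rewrite lerXn2r ?nnegrE// (le_trans y0).
have : 2 * r <= r ^+ 2 * sg ^+ 2 by rewrite expr2 -mulrA mulrC; nra.
have : 0 <= (sg ^+ 2 * r) ^+ 2 by rewrite sqr_ge0.
have : 0 <= sg ^+ 2 * r by lra.
nra.
Qed.

Lemma circ_area_step (R : realType) (r x y : R) : 0 < r -> 0 <= x <= y -> y <= r ->
  circ r y * (y - x) <= circ_area r y - circ_area r x <= circ r x * (y - x).
Proof.
move=> r0 /andP[x0 xy] yr.
have rx : - r <= x <= y by rewrite xy andbT; lra.
have [u [k [/andP[xu uy] k0]]] := circ_area_chord (circ r x) 0 r0 rx yr.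
have [v [l [/andP[xv vy] l0]]] := circ_area_chord (circ r y) 0 r0 rx yr.
have := @le_circ R r x u; rewrite x0 xu => /(_ isT) ux.
have := @le_circ R r v y; rewrite (le_trans x0 xv) vy => /(_ isT) yv.
rewrite !mul0r !addr0 => lE kE.
have : 0 <= k * (circ r x - circ r u) by rewrite mulr_ge0// subr_ge0.
have : 0 <= l * (circ r v - circ r y) by rewrite mulr_ge0// subr_ge0.
by move=> ? ?; apply/andP; split; lra.
Qed.

Lemma sum_trapezoid (R : realType) (A s : nat -> R) (N : nat) :
  \sum_(0 <= n < N) (A n.+1 - A n - (s n + s n.+1) / 2)
  = A N - A 0%N - (\sum_(1 <= n < N.+1) s n + s 0%N / 2 - s N / 2).
Proof.
elim: N => [|N IH]; first by rewrite !big_geq//; ring.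
by rewrite big_nat_recr//= IH [in RHS]big_nat_recr//=; field.
Qed.

(** The trapezoidal rule for the quarter disc.  Up to the abscissa
    [(1 - sg ^+ 2) * r] each trapezoid is exact up to [O(1 / r)]; beyond, each
    error is at most the decrease of the ordinate, and these decreases
    telescope to an ordinate at most [2 sg r].  The lower bound on [r] makes the
    accumulated interior error [2 / sg ^+ 3] at most [sg r]. *)
Lemma sum_circ (R : realType) (sg r : R) :
  0 < sg <= 1 / 2 -> 2 / sg ^+ 4 <= r ->
  `|\sum_(1 <= n < (Num.truncn r).+1) circ r n%:R - (pi * r ^+ 2 / 4 - r / 2)|
    <= 10 * sg * r.
Proof.
move=> /[dup] sgb /andP[sg0 sg1] rsg4.
have rsg : 2 / sg ^+ 2 <= r.
  apply: le_trans rsg4; apply: ler_wpM2l => //.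
  by rewrite lef_pV2 ?posrE ?exprn_gt0//; apply: ler_wiXn2l => //; lra.
have r0 : 0 < r by apply: lt_le_trans rsg; rewrite divr_gt0// exprn_gt0.
have /andP[Nr rN] := truncn_itv (ltW r0); rewrite -natr1 in rN.
set N := Num.truncn r in Nr rN *.
have Mr0 : 0 <= (1 - sg ^+ 2) * r by rewrite mulr_ge0// ?(ltW r0)//; nra.
have /andP[Mr rM] := truncn_itv Mr0; rewrite -natr1 in rM.
set M := Num.truncn _ in Mr rM.
have MN : (M <= N)%N.
  by apply: le_truncn; rewrite ler_piMl ?(ltW r0)// gerBl sqr_ge0.
pose A n := circ_area r n%:R; pose s n := circ r n%:R.
have s_ge0 n : 0 <= s n by rewrite sqrtr_ge0.
have pi2 : 0 < pi / 2 :> R by rewrite divr_gt0// pi_gt0.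
have area0 : A 0%N = 0.
  have := circ_area_sin (t := 0) r0; rewrite sin0 mulr0 /A => ->; first by ring.
  by apply/andP; split; lra.
have arear : circ_area r r = pi * r ^+ 2 / 4.
  have := circ_area_sin (t := pi / 2) r0; rewrite sin_pihalf cos_pihalf mulr1.
  by move=> ->; [field|apply/andP; split; lra].
have s0 : s 0%N = r by rewrite /s /circ expr0n subr0 sqrtr_sqr gtr0_norm.
have := circ_area_step r0 (x := N%:R) (y := r); rewrite ler0n Nr lexx.
move=> /(_ isT isT) /andP[_ last_le].
have := circ_area_chord 0 0 r0 (x := N%:R) (y := r).
rewrite Nr andbT => /(_ ltac:(have := ler0n R N; lra) (lexx _)) [u [k [_ k0]]].
rewrite !mul0r !addr0 !subr0 => last_ge.
have kc : 0 <= k * circ r u by rewrite mulr_ge0// sqrtr_ge0.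
have lastN : circ r N%:R * (r - N%:R) <= s N.
  by rewrite ler_piMr ?sqrtr_ge0//; lra.
have sM : s M <= 2 * sg * r by apply: circ_le_boundary => //; lra.
have sN : s N <= s M.
  by apply: le_circ; rewrite ler0n ler_nat.
pose D n := A n.+1 - A n - (s n + s n.+1) / 2.
have D1 : `|\sum_(0 <= n < M) D n| <= 2 / sg ^+ 3.
  apply: (@le_trans _ _ (\sum_(0 <= n < M) (2 / (sg ^+ 3 * r)))).
    apply: le_trans (ler_norm_sum _ _ _) _; rewrite !big_nat.
    apply: ler_sum => n /andP[_ nM]; rewrite /D /A /s -natr1.
    apply: circ_area_trapezoid => //; first by rewrite sg0; lra.
    apply: circ_ge_interior => //; rewrite addr_ge0//= natr1.
    by apply: le_trans Mr; rewrite ler_nat.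
  rewrite sumr_const_nat subn0 -[_ *+ M]mulr_natr.
  have -> : 2 / (sg ^+ 3 * r) * M%:R = 2 / sg ^+ 3 * (M%:R / r).
    by field; rewrite !gt_eqF.
  rewrite ler_piMr ?divr_ge0 ?exprn_ge0 ?(ltW sg0)// ler_pdivrMr// mul1r.
  by apply: le_trans Nr; rewrite ler_nat.
have D2 : `|\sum_(M <= n < N) D n| <= s M.
  apply: (@le_trans _ _ (\sum_(M <= n < N) (s n - s n.+1))).
    apply: le_trans (ler_norm_sum _ _ _) _; rewrite !big_nat.
    apply: ler_sum => n /andP[_ nN].
    have := circ_area_step r0 (x := n%:R) (y := n.+1%:R).
    rewrite ler0n ler_nat leqnSn (le_trans _ Nr) ?ler_nat// => /(_ isT isT).
    rewrite -/(A _) -/(A _) -/(s _) -/(s _) -natr1 [n%:R + 1 - _]addrAC subrr add0r !mulr1.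
    by move=> /andP[h1 h2]; rewrite ler_norml /D; apply/andP; split; lra.
  have -> : \sum_(M <= n < N) (s n - s n.+1) = s M - s N.
    have := telescope_sumr (fun n => - s n) MN.
    rewrite opprK addrC => <-; apply: eq_bigr => n _; ring.
  by rewrite gerBl.
have := sum_trapezoid A s N; rewrite -/D (@big_cat_nat _ _ _ M 0 N)//= area0 s0.
have : 2 / sg ^+ 3 <= sg * r.
  by move: rsg4; rewrite !ler_pdivrMr ?exprn_gt0//; lra.
move: D1 D2; rewrite !ler_norml -/s => /andP[? ?] /andP[? ?] ? E.
have := s_ge0 N; have := s_ge0 M; rewrite arear in last_ge last_le.
rewrite -/(s N) in last_le; rewrite -/(s N) in lastN; rewrite -/(A N) in last_ge last_le.
by move=> ? ?; apply/andP; split; lra.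
Qed.

(** The ordinates of the arc away from the vertical tangent form a slowly turning
    sequence with [c = a / r]; the remaining abscissas number
    [O(sg ^+ 2 * r)] and are estimated trivially. *)
Lemma sum_saw_circ (R : realType) (a eps : R) : 0 < a -> 0 < eps ->
  exists r0 : R, forall r, r0 <= r ->
  `|\sum_(1 <= n < (Num.truncn r).+1) saw (a * circ r n%:R)| <= eps * r.
Proof.
move=> a0 eps0.
pose sg : R := Num.min (1 / 2) (eps / 4).
have sg0 : 0 < sg by rewrite lt_min divr_gt0//= divr_gt0.
have sg1 : sg <= 1 / 2 by rewrite ge_min lexx.
have sge : sg ^+ 2 <= eps / 4.
  have : sg <= eps / 4 by rewrite ge_min lexx orbT.
  by rewrite expr2; nra.
pose eps' := eps / (4 * (1 + 1 / a)).
have a1 : 0 < 1 + 1 / a by rewrite addr_gt0// divr_gt0.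
have eps'0 : 0 < eps' by rewrite divr_gt0// mulr_gt0.
have P0 : 0 <= a / sg by rewrite divr_ge0// ltW.
have kap0 : 0 <= 2 / sg ^+ 3 by rewrite divr_ge0// exprn_ge0// ltW.
have [c0 c00 equi] := sum_saw_slowly_turning P0 kap0 eps'0.
exists (Num.max (a / c0) (Num.max 1 (8 / eps))) => r.
rewrite !ge_max => /andP[rc /andP[r1 reps]].
have r0 : 0 < r by lra.
move: reps; rewrite ler_pdivrMr// => reps.
have Mr0 : 0 <= (1 - sg ^+ 2) * r by rewrite mulr_ge0// ?(ltW r0)//; nra.
have /andP[Mr rM] := truncn_itv Mr0; rewrite -natr1 in rM.
set M := Num.truncn _ in Mr rM.
have /andP[Nr rN] := truncn_itv (ltW r0).
set N := Num.truncn r in Nr rN *.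
have MN : (M <= N)%N.
  by apply: le_truncn; rewrite ler_piMl ?(ltW r0)// gerBl sqr_ge0.
have sgr n : (n < M)%N -> sg * r <= circ r n%:R.
  move=> nM; apply: circ_ge_interior; rewrite ?sg0//= ler0n /=.
  by apply: le_trans Mr; rewrite ler_nat ltnW.
have sg1' : sg <= 1 by lra.
pose u n := a * circ r n%:R; pose b n := - (a * (n%:R / circ r n%:R)).
have ar0 : 0 < a / r by rewrite divr_gt0.
have main : `|\sum_(0 <= n < M) saw (u n)| <= eps' * (M%:R + 1 / (a / r)).
  apply: (equi _ _ _ b).
  - by rewrite ar0 /= ler_pdivrMr// mulrC -ler_pdivrMr.
  - move=> n nM; have /andP[h1 h2] := circ_slope_le sg0 r0 (ler0n _ n) (lexx _) (sgr n nM).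
    by rewrite normrN (ger0_norm (mulr_ge0 (ltW a0) h1)) ler_wpM2l ?(ltW a0).
  - move=> n k nkM; have nk : n%:R <= (n + k)%:R :> R by rewrite ler_nat leq_addr.
    have := circ_tangent sg0 sg1' r0 (ler0n _ n) nk (sgr _ nkM).
    have -> : (n + k)%:R - n%:R = k%:R :> R by rewrite natrD; ring.
    move=> /andP[h1 h2].
    have -> : u (n + k)%N - u n - b n * k%:R = - (a * (circ r n%:R - circ r (n + k)%:R
        - n%:R / circ r n%:R * k%:R)) by rewrite /u /b; ring.
    rewrite normrN (ger0_norm (mulr_ge0 (ltW a0) h1)).
    apply: le_trans (ler_wpM2l (ltW a0) h2) _.
    have -> : a * (k%:R ^+ 2 / (sg ^+ 3 * r)) = 1 / sg ^+ 3 * (a / r) * k%:R ^+ 2.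
      by field; rewrite !gt_eqF.
    rewrite ler_wpM2r ?sqr_ge0// ler_wpM2r ?(ltW ar0)// ler_wpM2r// ?ler1n//.
    by rewrite invr_ge0 exprn_ge0// ltW.
  - move=> n k nkM; have nk : n%:R <= (n + k)%:R :> R by rewrite ler_nat leq_addr.
    have := circ_slope_diff sg0 sg1' r0 (ler0n _ n) nk (sgr _ nkM).
    have -> : (n + k)%:R - n%:R = k%:R :> R by rewrite natrD; ring.
    move=> /andP[h1 h2].
    have -> : b (n + k)%N - b n = - (a * ((n + k)%:R / circ r (n + k)%:R
       - n%:R / circ r n%:R)) by rewrite /b; ring.
    have kr0 : 0 <= k%:R / r by rewrite divr_ge0// ltW.
    rewrite normrN (ger0_norm (mulr_ge0 (ltW a0) (le_trans kr0 h1))).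
    have -> : a / r * k%:R = a * (k%:R / r) by ring.
    have -> : 2 / sg ^+ 3 * (a / r) * k%:R = a * (2 * k%:R / (sg ^+ 3 * r)).
      by field; rewrite !gt_eqF.
    by rewrite !ler_wpM2l ?(ltW a0).
have : eps' * (M%:R + 1 / (a / r)) <= eps / 4 * r.
  apply: (@le_trans _ _ (eps' * ((1 + 1 / a) * r))).
    apply: ler_wpM2l; first exact: ltW.
    have -> : (1 + 1 / a) * r = r + 1 / (a / r) by field; rewrite !gt_eqF.
    by rewrite lerD2r (le_trans _ Nr)// ler_nat.
  have -> : eps' = eps / 4 / (1 + 1 / a) by rewrite /eps'; field; rewrite !gt_eqF//; lra.
  by rewrite mulrA divfK ?gt_eqF.
have tail : `|\sum_(M <= n < N.+1) saw (u n)| <= (N.+1 - M)%:R / 2.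
  apply: le_trans (ler_norm_sum _ _ _) _.
  apply: (@le_trans _ _ (\sum_(M <= n < N.+1) (1 / 2))).
    by apply: ler_sum => n _; exact: norm_saw_le.
  by rewrite sumr_const_nat -[_ *+ _]mulr_natr; lra.
have := norm_saw_le (u 0%N).
have E : \sum_(0 <= n < M) saw (u n) + \sum_(M <= n < N.+1) saw (u n) =
    saw (u 0%N) + \sum_(1 <= n < N.+1) saw (u n).
  rewrite -big_cat_nat//=; last exact: leqW.
  by rewrite big_ltn.
have -> : \sum_(1 <= n < N.+1) saw (a * circ r n%:R) =
  \sum_(0 <= n < M) saw (u n) + \sum_(M <= n < N.+1) saw (u n) - saw (u 0%N).
  by rewrite E /u; ring.
move: tail main; rewrite natrB ?(leqW MN)// -natr1 !ler_norml.
have : sg ^+ 2 * r <= eps / 4 * r by rewrite ler_wpM2r// ltW.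
move=> h /andP[? ?] /andP[? ?] /andP[? ?] ?; apply/andP; split; lra.
Qed.

(** Lattice points in a quarter ellipse, off the axes, up to [o(r)]: the floor is
    the ordinate minus one half minus the sawtooth. *)
Lemma sum_floor_circ (R : realType) (a eps : R) : 0 < a -> 0 < eps ->
  exists r0 : R, forall r, r0 <= r ->
  `|(\sum_(1 <= n < (Num.truncn r).+1) Num.floor (a * circ r n%:R))%:~R
      - (pi * a / 4 * r ^+ 2 - (1 + a) / 2 * r)| <= eps * r.
Proof.
move=> a0 eps0.
pose sg : R := Num.min (1 / 2) (eps / (40 * a)).
have sg0 : 0 < sg by rewrite lt_min !divr_gt0// mulr_gt0.
have sg1 : 0 < sg <= 1 / 2 by rewrite sg0 ge_min lexx.
have sge : 40 * (a * sg) <= eps.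
  have : sg <= eps / (40 * a) by rewrite ge_min lexx orbT.
  by rewrite ler_pdivlMr ?mulr_gt0//; lra.
have eps4 : 0 < eps / 4 by rewrite divr_gt0.
have [r0 sawE] := sum_saw_circ a0 eps4.
exists (Num.max r0 (Num.max (2 / sg ^+ 4) (2 / eps))) => r.
rewrite !ge_max => /andP[/sawE saw_le /andP[rsg reps]].
have r_gt0 : 0 < r by apply: lt_le_trans rsg; rewrite divr_gt0// exprn_gt0.
have := sum_circ sg1 rsg.
have /andP[Nr rN] := truncn_itv (ltW r_gt0); rewrite -natr1 in rN.
move: reps; rewrite ler_pdivrMr// => reps.
have : 40 * (a * sg) * r <= eps * r by rewrite ler_wpM2r// ltW.
set N := Num.truncn r in Nr rN saw_le *.
set S := \sum_(1 <= n < N.+1) circ r n%:R => sgr SE.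
have {}SE : `|a * S - a * (pi * r ^+ 2 / 4 - r / 2)| <= a * (10 * sg * r).
  by rewrite -mulrBr normrM gtr0_norm// ler_wpM2l// ltW.
have E : (\sum_(1 <= n < N.+1) Num.floor (a * circ r n%:R))%:~R =
    a * S - \sum_(1 <= n < N.+1) saw (a * circ r n%:R) - N%:R / 2.
  rewrite rmorph_sum mulr_sumr /=.
  have -> : N%:R / 2 = \sum_(1 <= n < N.+1) (1 / 2) :> R.
    by rewrite sumr_const_nat subn1 -[_ *+ _]mulr_natr /=; ring.
  by rewrite -!sumrB; apply: eq_bigr => n _; rewrite /saw; ring.
rewrite E; move: saw_le SE; rewrite !ler_norml => /andP[? ?] /andP[? ?].
by apply/andP; split; lra.
Qed.

(** * The two counting functions *)

Definition wave_count (R : realType) (h X : R) : int :=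
  Num.floor (h / pi * Num.sqrt X)
  + 2 * (\sum_(1 <= n < (Num.truncn (Num.sqrt X)).+1)
           Num.floor (h / pi * Num.sqrt (X - n%:R ^+ 2))).

(** Twice the quarter ellipse accounts for [h / 2 * X] and for a boundary term
    [- (1 + h / pi) * Num.sqrt X], whose part along the other axis is cancelled
    by the isolated floor. *)
Lemma wave_count_asymptotics (R : realType) (h eps : R) : 0 < h -> 0 < eps ->
  exists X0 : R, forall X, X0 <= X ->
  `|(wave_count h X)%:~R - (h / 2 * X - Num.sqrt X)| <= eps * Num.sqrt X.
Proof.
move=> h0 eps0.
have pi0 : 0 < pi :> R := pi_gt0 R.
have eps4 : 0 < eps / 4 by rewrite divr_gt0.
have a0 : 0 < h / pi by rewrite divr_gt0.
have [r0 rE] := sum_floor_circ a0 eps4.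
exists ((Num.max r0 (2 / eps)) ^+ 2) => X XE.
have X0 : 0 <= X by apply: le_trans XE; rewrite sqr_ge0.
have : Num.max r0 (2 / eps) <= Num.sqrt X.
  by apply: le_trans (ler_norm _) _; rewrite -sqrtr_sqr ler_wsqrtr.
rewrite ge_max ler_pdivrMr// => /andP[/rE {}rE reps].
rewrite /wave_count; move: rE reps; rewrite /circ sqr_sqrtr//.
set r := Num.sqrt X; set S := \sum_(_ <= _ < _) _.
have -> : pi * (h / pi) = h by rewrite mulrC divfK ?gt_eqF.
move=> rE reps.
have /andP[] := floor_itv (h / pi * r).
rewrite !intrD [(2 * S)%:~R]intrM; move: rE; rewrite !ler_norml => /andP[? ?] ? ?.
by apply/andP; split; lra.
Qed.

Theorem proposition3p3 (R : realType) (h lambda mu : R)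
    (h_gt0 : 0 < h) (mu_gt0 : 0 < mu) (lambdaDmu_gt0 : 0 < lambda + mu) :
  (fun Lambda : R => (N_DF h lambda mu Lambda)%:~R : R) =
    (fun Lambda : R =>
       h / 2 * (1 / mu + 1 / (lambda + 2 * mu)) * Lambda
       + (1 / Num.sqrt mu - 1 / Num.sqrt (lambda + 2 * mu)) * Num.sqrt Lambda)
    +o_ (+oo_R) (fun Lambda : R => Num.sqrt Lambda)
  /\
  (fun Lambda : R => (N_FD h lambda mu Lambda)%:~R : R) =
    (fun Lambda : R =>
       h / 2 * (1 / mu + 1 / (lambda + 2 * mu)) * Lambda
       - (1 / Num.sqrt mu - 1 / Num.sqrt (lambda + 2 * mu)) * Num.sqrt Lambda)
    +o_ (+oo_R) (fun Lambda : R => Num.sqrt Lambda).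
Proof.
set nu := lambda + 2 * mu.
have nu_gt0 : 0 < nu by rewrite /nu; lra.
have DF L : N_DF h lambda mu L = wave_count h (L / nu) + wave_count h (L / mu)
    + 2 * Num.floor (Num.sqrt (L / mu)).
  by rewrite /N_DF /wave_count -/nu; ring.
have FD L : N_FD h lambda mu L = wave_count h (L / nu) + wave_count h (L / mu)
    + 2 * Num.floor (Num.sqrt (L / nu)).
  by rewrite /N_FD DF -/nu; ring.
have waves (eps : R) : 0 < eps -> exists L0 : R, forall L, L0 <= L ->
  [/\ 0 <= L, 4 <= eps * Num.sqrt L &
    `|(wave_count h (L / nu) + wave_count h (L / mu))%:~R
      - (h / 2 * (1 / mu + 1 / nu) * L - Num.sqrt (L / nu) - Num.sqrt (L / mu))|
    <= eps / 2 * Num.sqrt L].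
  move=> eps0.
  pose s := (Num.sqrt nu)^-1 + (Num.sqrt mu)^-1.
  have s0 : 0 < s by rewrite addr_gt0// invr_gt0 sqrtr_gt0.
  have d0 : 0 < eps / 2 / s by rewrite !divr_gt0.
  have [X0 XE] := wave_count_asymptotics h_gt0 d0.
  exists (Num.max (X0 * nu) (Num.max (X0 * mu) ((4 / eps) ^+ 2))) => L.
  rewrite !ge_max -(ler_pdivlMr _ _ nu_gt0) -(ler_pdivlMr _ _ mu_gt0).
  move=> /andP[/XE nuE /andP[/XE muE epsE]].
  have L0 : 0 <= L by apply: le_trans epsE; rewrite sqr_ge0.
  split=> //.
    rewrite mulrC -ler_pdivrMr//; apply: le_trans (ler_norm _) _.
    by rewrite -sqrtr_sqr ler_wsqrtr.
  have sE : eps / 2 * Num.sqrt L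
      = eps / 2 / s * Num.sqrt (L / nu) + eps / 2 / s * Num.sqrt (L / mu).
    rewrite !sqrtrM// !sqrtrV ?(ltW nu_gt0) ?(ltW mu_gt0)// -mulrDr -mulrDr -/s.
    by field; rewrite gt_eqF.
  rewrite sE intrD; move: nuE muE; rewrite !ler_norml => /andP[? ?] /andP[? ?].
  by apply/andP; split; lra.
have root (L c : R) : 0 <= L -> 0 < c ->
    Num.sqrt (L / c) = 1 / Num.sqrt c * Num.sqrt L.
  by move=> L0 c0; rewrite sqrtrM// sqrtrV ?(ltW c0)//; ring.
have near_infty (f g : R -> R) :
    (forall eps, 0 < eps -> exists L0 : R, forall L, L0 <= L ->
       `|f L - g L| <= eps * Num.sqrt L) ->
    f = g +o_ (+oo_R) (fun L : R => Num.sqrt L).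
  move=> fg; apply/eqaddoP => eps eps0; have [L0 fgE] := fg eps eps0.
  near=> L; rewrite [X in _ <= _ * X]ger0_norm ?sqrtr_ge0//; apply: fgE.
  by near: L; apply: nbhs_pinfty_ge; exact: num_real.
split; apply: near_infty => eps eps0; have [L0 LE] := waves eps eps0.
all: exists L0 => L /LE[L_ge0 reps].
all: rewrite ?DF ?FD !(root L) // ?intrD ?intrM !ler_norml => /andP[? ?].
- have /andP[] := floor_itv (1 / Num.sqrt mu * Num.sqrt L); rewrite intrD => ? ?.
  by apply/andP; split; lra.
- have /andP[] := floor_itv (1 / Num.sqrt nu * Num.sqrt L); rewrite intrD => ? ?.
  by apply/andP; split; lra.
Unshelve. all: by end_near. Qed.
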